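(* Let $\Lambda$ be a set and let $\Gamma$ be a subshift of $\Lambda^\omega$. Then $\Gamma$ is a subshift of bounded type if and only if the system $(\Gamma,\sigma)$ has the shadowing property.
   Context: Let $\omega=\{0,1,2,\dots\}$. $\Lambda$ is an arbitrary (possibly infinite) set. $\Lambda^\omega$ is the set of infinite sequences $x=x_0x_1x_2\cdots$ over $\Lambda$, with the product topology where $\Lambda$ is discrete, metrized by $d(x,y)=\inf\{2^{-n}: x_i=y_i \text{ for all } i<n\}$; the shift map is $\sigma(x_0x_1x_2\cdots)=x_1x_2\cdots$. A subshift of $\Lambda^\omega$ is a closed set $\Gamma\subseteq\Lambda^\omega$ with $\sigma(\Gamma)=\Gamma$. A word is a finite sequence over $\Lambda$ of length at least $1$; it is allowed for $\Gamma$ if it occurs as a block of consecutive symbols (subword) of some $x\in\Gamma$, and forbidden otherwise. A basis for the forbidden words of $\Gamma$ is a set $\mathcal F$ of forbidden words such that every forbidden word contains some element of $\mathcal F$ as a subword. $\Gamma$ is a subshift of bounded type (SBT) if it has a basis for its forbidden words whose elements have uniformly bounded length. For a map $f:X\to X$ on a metric space and $\delta>0$, a $\delta$-pseudo-orbit is a sequence $\langle x_i\rangle_{i\in\omega}$ in $X$ with $d(f(x_i),x_{i+1})<\delta$ for all $i$. $(X,f)$ has the shadowing property if for all $\epsilon>0$ there exists $\delta>0$ such that for every $\delta$-pseudo-orbit $\langle x_i\rangle$ of $f$ there is $z\in X$ with $d(f^i(z),x_i)<\epsilon$ for all $i\in\omega$. *)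

(* Defs.v *)
From HB Require Import structures.
From mathcomp Require Import all_boot all_order all_algebra.
From mathcomp Require Import all_classical all_reals all_analysis.

Set Implicit Arguments.
Unset Strict Implicit.
Unset Printing Implicit Defensive.

Import Order.TTheory GRing.Theory Num.Theory.

Local Open Scope classical_set_scope.
Local Open Scope ring_scope.

Section Shadowing.
Variables (R : realType) (X : Type) (d : X -> X -> R) (f : X -> X).

(* In both definitions [A] is the phase space: pseudo-orbits live in [A] and
   the shadowing point is taken in [A].  The system [(A, f)], with the metric
   [d] restricted to [A], makes sense when [f] maps [A] to itself. *)
Definition pseudo_orbit (A : set X) (delta : R) (x : nat -> X) : Prop :=
  (forall i, A (x i)) /\ (forall i, d (f (x i)) (x i.+1) < delta).

Definition shadowing_property (A : set X) : Prop :=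
  forall eps : R, 0 < eps -> exists2 delta : R, 0 < delta &
    forall x : nat -> X, pseudo_orbit A delta x ->
      exists2 z : X, A z & forall i, d (iter i f z) (x i) < eps.

End Shadowing.

Section Subshifts.
Variable L : Type.

Definition shift_map (x : nat -> L) : nat -> L := fun i => x i.+1.

(* [{classic L}] only equips [L] with the choice structure that the topology
   hierarchy requires of every carrier; [L] itself is an arbitrary type. *)
Definition subshift (G : set (nat -> L)) : Prop :=
  closed (G : set {ptws nat -> discrete_topology {classic L}}) /\
  shift_map @` G = G.

Definition seq_dist (R : realType) (x y : nat -> L) : R :=
  inf [set (2 : R) ^- n | n in [set n | forall i, (i < n)%N -> x i = y i]].

Definition is_word (w : seq L) : Prop := (0 < size w)%N.

Definition subword (u w : seq L) : Prop := exists s t, w = s ++ u ++ t.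

Definition occurs_in (w : seq L) (x : nat -> L) : Prop :=
  exists i, w = mkseq (fun j => x (i + j)%N) (size w).

Definition allowed (G : set (nat -> L)) (w : seq L) : Prop :=
  is_word w /\ exists2 x, G x & occurs_in w x.

Definition forbidden (G : set (nat -> L)) (w : seq L) : Prop :=
  is_word w /\ ~ allowed G w.

Definition forbidden_basis (G : set (nat -> L)) (F : set (seq L)) : Prop :=
  F `<=` forbidden G /\
  forall w, forbidden G w -> exists2 u, F u & subword u w.

Definition bounded_type (G : set (nat -> L)) : Prop :=
  exists2 F, forbidden_basis G F & exists N, forall u, F u -> (size u <= N)%N.

End Subshifts.

(* Main.v *)
(** Two sequences are at distance less than 2^-n exactly when they agree up to
    index n.  If the forbidden words have a basis of length at most N, the only
    candidate for shadowing a fine pseudo-orbit x is z_i = (x_i)_0: its short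
    words all occur in some x_i, so they are allowed, hence all words of z are,
    and z lies in the closed set G.  Conversely, let 2^-N < delta where delta
    witnesses shadowing for eps = 1.  If every subword of w of length at most
    N+2 is allowed, points of G realizing the successive windows of w of length
    N+2 form a delta-pseudo-orbit, and a point shadowing it starts with w. *)
Require Import Defs.
From mathcomp Require Import all_boot all_order all_algebra.
From mathcomp Require Import all_classical all_reals all_analysis.
From mathcomp Require Import zify.

Set Implicit Arguments.
Unset Strict Implicit.
Unset Printing Implicit Defensive.

Import Order.TTheory GRing.Theory Num.Theory.

Local Open Scope classical_set_scope.
Local Open Scope ring_scope.

Lemma exp2N_lt_small (R : realType) (e : R) :
  0 < e -> exists n : nat, (2 : R) ^- n < e.
Proof.
move=> e0; have [n _ /(_ n (leqnn n)) /=] := near_infty_natSinv_expn_lt (PosNum e0).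
by rewrite div1r => ?; exists n.
Qed.

Section Sequences.
Variable L : Type.
Implicit Types (x y z : nat -> L) (G : set (nat -> L)) (u w : seq L).

Lemma iter_shift_mapE k x j : iter k (@shift_map L) x j = x (k + j)%N.
Proof. by elim: k j => // k IH j; rewrite /= /shift_map IH addnS. Qed.

(** An infimum below [2 ^- n] is undercut by some [2 ^- m] with [m > n]; conversely, agreement
    through index [n] puts [2 ^- n.+1] in the set. *)
Lemma seq_dist_lt (R : realType) x y n :
  seq_dist R x y < 2 ^- n <-> forall i, (i <= n)%N -> x i = y i.
Proof.
split=> [|xy].
  move/inf_lt => [|_ [m /= xy <-]]; first by exists (2 ^- 0), 0%N.
  by rewrite ltf_pV2 ?posrE ?exprn_gt0// ltr_eXn2l ?ltr1n// => nm i /leq_ltn_trans; auto.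
apply: (@le_lt_trans _ _ (2 ^- n.+1)).
  by apply: ge_inf; [exists 0 => _ [m _ <-]; rewrite invr_ge0 exprn_ge0|exists n.+1].
by rewrite ltf_pV2 ?posrE ?exprn_gt0// ltr_eXn2l ?ltr1n.
Qed.

Lemma occurs_inP (x0 : L) w x : occurs_in w x <->
  exists i, forall j, (j < size w)%N -> x (i + j)%N = nth x0 w j.
Proof.
split=> -[i wx]; exists i.
  by move=> j jw; rewrite wx nth_mkseq.
apply: (@eq_from_nth _ x0); first by rewrite size_mkseq.
by move=> j jw; rewrite nth_mkseq ?wx.
Qed.

Lemma occurs_in_subword u w x : subword u w -> occurs_in w x -> occurs_in u x.
Proof.
case: u => [|x0 u]; first by exists 0%N.
move=> [s [t ->]] /(occurs_inP x0)[i ix]; apply/(occurs_inP x0).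
exists (i + size s)%N => j ju; rewrite -addnA ix.
  by rewrite nth_cat ifN -?leqNgt ?leq_addr// addKn nth_cat ju.
by rewrite !size_cat ltn_add2l ltn_addr.
Qed.

(** Points of [G] agreeing with [z] on ever longer prefixes converge to [z], since each coordinate
    is eventually constant. *)
Lemma closed_prefix G z :
  closed (G : set {ptws nat -> discrete_topology {classic L}}) ->
  (forall n, exists2 y, G y & forall i, (i < n)%N -> y i = z i) -> G z.
Proof.
move=> cG prefG.
have /choice[y yP] n : exists y, G y /\ forall i, (i < n)%N -> y i = z i.
  by have [y] := prefG n; exists y.
apply: (@closed_cvg _ {ptws nat -> discrete_topology {classic L}}
                    \oo _ y G cG _ z); first by apply: nearW => n; case: (yP n).
apply/pointwise_cvgP => i; apply: cvg_near_cst.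
by exists i.+1 => // n /= ni; have [_ ->] := yP n.
Qed.

Lemma subshift_iter G k x : subshift G -> G x -> G (iter k (@shift_map L) x).
Proof.
move=> [_ sG] Gx; elim: k => //= k IH; rewrite -sG.
by exists (iter k (@shift_map L) x).
Qed.

(** Shift invariance lets an occurrence be moved to index 0 without leaving [G]. *)
Lemma subshift_allowed_prefix G w (x0 : L) : subshift G -> allowed G w ->
  exists2 y, G y & forall j, (j < size w)%N -> y j = nth x0 w j.
Proof.
move=> sG [_ [x Gx /(occurs_inP x0)[i xw]]].
exists (iter i (@shift_map L) x); first exact: subshift_iter.
by move=> j jw; rewrite iter_shift_mapE xw.
Qed.

Lemma subshift_mem G z : subshift G ->
  (forall n, allowed G (mkseq z n.+1)) -> G z.
Proof.
move=> sG zG; apply: closed_prefix => [|n]; first by case: sG.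
have [y Gy yz] := subshift_allowed_prefix (z 0%N) sG (zG n).
exists y => // i ni; have ni1 : (i < n.+1)%N by exact: ltnW.
by rewrite yz ?size_mkseq// nth_mkseq.
Qed.

Lemma bounded_type_shadowing (R : realType) G : subshift G ->
  bounded_type G -> shadowing_property (@seq_dist L R) (@shift_map L) G.
Proof.
move=> sG [F [Ff Fb] [N FN]] e e0; have [n ne] := exp2N_lt_small e0.
(* [N] serves to place [z] in [G], [n] to bring its orbit within [e] of [x]. *)
exists (2 ^- (maxn N n)); first by rewrite invr_gt0 exprn_gt0.
move=> x [Gx xd]; pose z i := x i 0%N.
(* Symbol [j.+1] of [x i] is symbol [j] of [x i.+1], by the pseudo-orbit bound. *)
have xz j i : (j <= maxn N n)%N -> x i j = z (i + j)%N.
  elim: j i => [|j IH] i jM; first by rewrite addn0.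
  have /seq_dist_lt/(_ j (ltnW jM)) := xd i.
  by rewrite /shift_map => ->; rewrite IH 1?ltnW// addSnnS.
exists z; last first.
  move=> i; apply: lt_trans ne; apply/seq_dist_lt => j jn.
  by rewrite iter_shift_mapE xz// (leq_trans jn)// leq_maxr.
apply: subshift_mem => // k; apply: contrapT => nw.
have [u Fu uw] : exists2 u, F u & subword u (mkseq z k.+1).
  by apply: Fb; split=> //; rewrite /is_word size_mkseq.
have [wu []] := Ff _ Fu; split=> //.
have /(occurs_in_subword uw) [i ->] : occurs_in (mkseq z k.+1) z.
  by exists 0%N; rewrite size_mkseq.
exists (x i) => //; exists 0%N; rewrite !size_mkseq.
apply/eq_in_map => j; rewrite mem_iota /= add0n => ju.
by rewrite xz// (leq_trans (ltnW ju))// (leq_trans (FN _ Fu))// leq_maxl.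
Qed.

Lemma shadowing_bounded_type (R : realType) G : subshift G ->
  shadowing_property (@seq_dist L R) (@shift_map L) G -> bounded_type G.
Proof.
move=> sG /(_ 1 ltr01)[d d0 shd]; have [N Nd] := exp2N_lt_small d0.
(* Length [N.+2]: agreement of the shift of one point with the next through index [N] involves
   symbols 1 to [N.+1] of the former. *)
exists [set u | forbidden G u /\ (size u <= N.+2)%N]; last by exists N.+2 => u [].
split=> [u []//|w fw]; apply: contrapT => nF.
have smallG u : is_word u -> subword u w -> (size u <= N.+2)%N -> allowed G u.
  by move=> u0 uw uN; apply: contrapT => nu; apply: nF; exists u.
have [w0 nw] := fw; apply: nw.
have [wN|Nw] := leqP (size w) N.+2.
  by apply: smallG => //; exists [::], [::]; rewrite cats0.
have [x0 _] : exists x0 : L, True by case: (w) w0 => // x0; exists x0.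
pose k := (size w - N.+2)%N.
have /choice[y yP] (i : nat) : exists y, G y /\
    ((i <= k)%N -> forall j, (j < N.+2)%N -> y j = nth x0 w (i + j)).
  (* Capping at [k], the start of the last window, makes the choice total. *)
  pose i' := minn i k; pose u := take N.+2 (drop i' w).
  have su : size u = N.+2 by rewrite size_takel // size_drop /i' /k; lia.
  have [|y Gy yu] := @subshift_allowed_prefix G u x0 sG.
    apply: smallG; rewrite /is_word ?su//.
    by exists (take i' w), (drop N.+2 (drop i' w)); rewrite !cat_take_drop.
  exists y; split=> // ik j jN; rewrite yu ?su// nth_take// nth_drop.
  by rewrite /i'; move/minn_idPl: ik => ->.
(* Past the last window, [x] is the true orbit of [y k] (the subtraction is
   truncated). *)
pose x i := iter (i - k) (@shift_map L) (y (minn i k)).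
have [|z Gz zx] := shd x.
  split=> [i|i]; first by apply: subshift_iter => //; case: (yP (minn i k)).
  apply: lt_trans Nd; apply/seq_dist_lt => j jN.
  rewrite /shift_map /x !iter_shift_mapE.
  (* Before [k], consecutive windows overlap in [N.+1] letters of [w]; from [k] on, the orbit is
     exact. *)
  have [ik|ki] := ltnP i k.
    have [_ y1] := yP i; have [_ y2] := yP i.+1.
    have -> : minn i.+1 k = i.+1 by lia.
    have -> : (i - k + j.+1 = j.+1)%N by lia.
    have -> : (i.+1 - k + j = j)%N by lia.
    by rewrite y1 ?y2 ?addSnnS//; lia.
  have -> : minn i.+1 k = k by lia.
  by congr (y k _); lia.
split=> //; exists z => //; apply/(occurs_inP x0); exists 0%N => j jw.
(* As 1 is [2 ^- 0], shadowing gives equality of the symbols at index 0. *)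
have := zx j; rewrite -[X in _ < X]invr1 -(expr0 2) => /seq_dist_lt/(_ 0%N isT).
rewrite iter_shift_mapE addn0 add0n => ->; rewrite /x iter_shift_mapE addn0.
(* Letter [j] of [w] lies in window [minn j k] at the truncated offset [j - k], below [N.+2]. *)
have [_ ->] := yP (minn j k); [congr nth| |]; lia.
Qed.

End Sequences.

Theorem theorem10 (R : realType) (L : Type) (G : set (nat -> L)) :
  subshift G ->
  (bounded_type G <-> shadowing_property (@seq_dist L R) (@shift_map L) G).
Proof.
by move=> sG; split; [exact: bounded_type_shadowing|exact: shadowing_bounded_type].
Qed.
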